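(* Let $T>0$. The kernel $\varkappa_H$ defined in the context equals: (i) for $H\in(0,1/2)$, $$\varkappa_H(t,v)=\frac{1}{|t-v|^{2H}}\,B\left(\frac{T/(t\vee v)-1}{T/(t\wedge v)-1},\frac12-H,2H\right),\quad t,v\in[0,T],$$ where the numerator, i.e. the function $(t,v)\mapsto B\left(\frac{T/(t\vee v)-1}{T/(t\wedge v)-1},\frac12-H,2H\right)$, is bounded on $[0,T]^2$ but has no limit at the points $(0,0)$ and $(T,T)$; (ii) for $H\in(1/2,1)$, $$\varkappa_H(t,v)=\frac{1}{|t-v|^{2-2H}}\,B\left(H-\frac12,2-2H\right),\quad t,v\in[0,T].$$
   Context: Notation: $t\vee v=\max(t,v)$, $t\wedge v=\min(t,v)$. The kernel is $$\varkappa_H(t,v)=\begin{cases}(tv)^{1/2-H}\displaystyle\int_{t\vee v}^T (z-t)^{-1/2-H}z^{2H-1}(z-v)^{-1/2-H}\,dz, & H\in(0,1/2),\\[2mm] (tv)^{H-1/2}\displaystyle\int_0^{t\wedge v}(t-z)^{H-3/2}z^{1-2H}(v-z)^{H-3/2}\,dz, & H\in(1/2,1).\end{cases}$$ $B(\alpha,\beta)$ (two arguments) is the Beta function, and $B(x,\alpha,\beta)$ (three arguments) is the incomplete Beta function, defined for $x\in[0,1]$ and $\alpha,\beta>0$ by $B(x,\alpha,\beta)=\int_0^x y^{\alpha-1}(1-y)^{\beta-1}\,dy$.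
   Formalization: In (ii) the identity fails where t=0 or v=0 (the kernel is 0 there, the right side positive or infinite); it is proved for t,v in (0,T], and at points with t=0 or v=0 as the limit of the kernel from (0,T]². In (i) the undefined ratio at (0,0) and (T,T) is taken as 0. *)

(* Defs.v *)
From mathcomp Require Import all_boot all_order all_algebra.
From mathcomp Require Import all_classical all_reals all_analysis.
Set Implicit Arguments.
Unset Strict Implicit.
Unset Printing Implicit Defensive.
Import Order.TTheory GRing.Theory Num.Theory.
Import numFieldNormedType.Exports.
Local Open Scope classical_set_scope.
Local Open Scope ring_scope.

Definition Beta (R : realType) (a b : R) : R :=
  \int[@lebesgue_measure R]_(y in `[0, 1])
    (y `^ (a - 1) * (1 - y) `^ (b - 1)).

Definition incBeta (R : realType) (x a b : R) : R :=
  \int[@lebesgue_measure R]_(y in `[0, x])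
    (y `^ (a - 1) * (1 - y) `^ (b - 1)).

(* The kernel takes values in [0, +oo]: on the diagonal the integrals of these
   nonnegative functions diverge.  Integrating over open intervals keeps all
   the bases of the real powers positive (in the library 0 `^ a = 0 for every
   a != 0, including a < 0). *)
Definition varkappa (R : realType) (H T t v : R) : \bar R :=
  if H < 2^-1 then
    (((t * v) `^ (2^-1 - H))%:E *
     \int[@lebesgue_measure R]_(z in `]Num.max t v, T[)
       ((z - t) `^ (- 2^-1 - H) * z `^ (2 * H - 1)
        * (z - v) `^ (- 2^-1 - H))%:E)%E
  else
    (((t * v) `^ (H - 2^-1))%:E *
     \int[@lebesgue_measure R]_(z in `]0%R, Num.min t v[)
       ((t - z) `^ (H - 3 / 2) * z `^ (1 - 2 * H)
        * (v - z) `^ (H - 3 / 2))%:E)%E.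

(* The argument of the incomplete Beta function.  The divisions are those of
   the extended reals, with T / 0 = +oo and x / +oo = 0; hence the ratio is 0
   when exactly one of t, v is 0.  At (0, 0) and (T, T), where the ratio is the
   indeterminate oo / oo or 0 / 0, it takes the conventional value 0. *)
Definition beta_arg (R : realType) (T t v : R) : R :=
  fine ((T%:E / (Num.max t v)%:E - 1) / (T%:E / (Num.min t v)%:E - 1))%E.

Definition numerator (R : realType) (H T : R) (p : R * R) : R :=
  incBeta (beta_arg T p.1 p.2) (2^-1 - H) (2 * H).

(* Main.v *)
Require Import Defs.
From mathcomp Require Import all_boot all_order all_algebra.
From mathcomp Require Import all_classical all_reals all_analysis.
From mathcomp Require Import measurable_realfun ring lra.
Import Order.TTheory GRing.Theory Num.Theory.
Import numFieldNormedType.Exports.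
Local Open Scope classical_set_scope.
Local Open Scope ring_scope.

Set Implicit Arguments.
Unset Strict Implicit.
Unset Printing Implicit Defensive.

(* The substitution [y = s (z - r) / (r (z - s))] turns both integrals into
   incomplete Beta integrals: [s, r = t, v] with [t < v] for H < 1/2, and
   [s, r = v, t] for H > 1/2; in either case the exponents satisfy
   [2 alpha + beta = 1], which makes the powers of [r] cancel.  Since the
   integrands are singular at the endpoints, the substitution is carried out on
   primitives: the incomplete Beta function composed with the Moebius map is a
   primitive of the kernel, and the fundamental theorem of calculus is extended
   to open intervals by monotone convergence.  On the diagonal the primitive is
   a power of [z / (z - s)], so the integral diverges.  At the corners (0, 0)
   and (T, T) the numerator is the complete Beta value along the diagonal and 0
   along an edge of the square. *)

(** * Fundamental theorem of calculus on open intervals *)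

Lemma within_itv_continuous (R : realType) (f : R -> R) (a b c d : R) :
  a < c -> d < b -> {in `]a, b[, continuous f} ->
  {within `[c, d], continuous f}.
Proof.
move=> ac db cf; apply/continuous_in_subspaceT => x /[!inE]/=.
rewrite in_itv/= => /andP[cx xd]; apply: cf.
by rewrite in_itv/= (lt_le_trans ac)// (le_lt_trans xd).
Qed.

(** The limits [l] and [r] of the primitive may be infinite, so that convergent and divergent
    integrals are treated alike; [r +? - l] excludes the indeterminate differences. Nonnegativity of
    [f] gives monotone convergence along an exhaustion of the interval by the compact intervals
    [D n]. *)
Lemma ge0_continuous_FTC2oo (R : realType) (f F : R -> R) (a b : R)
    (l r : \bar R) : a < b ->
  {in `]a, b[, continuous f} -> {in `]a, b[, forall x, 0 <= f x} ->
  {in `]a, b[, forall x : R, is_derive x 1 F (f x)} ->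
  (F x)%:E @[x --> a^'+] --> l -> (F x)%:E @[x --> b^'-] --> r ->
  (r +? - l)%E ->
  (\int[@lebesgue_measure R]_(x in `]a, b[) (f x)%:E = r - l)%E.
Proof.
move=> ab cf f0 dF Fl Fr rl.
(* As [harmonic 0 = 1], the factor [(b - a) / 3] already makes the first interval [D 0]
   nondegenerate: it is the middle third. *)
pose e n : R := (b - a) / 3 * harmonic n.
have e0 n : 0 < e n by rewrite mulr_gt0 ?harmonic_gt0// divr_gt0// subr_gt0.
have eS m n : (m <= n)%N -> e n <= e m.
  move=> mn; rewrite /e ler_pM2l ?divr_gt0 ?subr_gt0//.
  by rewrite lef_pV2 ?posrE// ler_nat.
have eba n : a + e n < b - e n.
  have := eS _ _ (leq0n n); rewrite {2}/e/harmonic/= invr1 mulr1; lra.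
have ecvg : e n @[n --> \oo] --> 0.
  by rewrite -(mulr0 ((b - a) / 3)); apply: cvgMr; exact: cvg_harmonic.
pose D n : set R := `[a + e n, b - e n]%classic.
have DE : `]a, b[%classic = \bigcup_n D n.
  apply/seteqP; split=> x /=.
    rewrite in_itv/= => /andP[ax xb].
    have m0 : 0 < Num.min (x - a) (b - x) by rewrite lt_min !subr_gt0 ax.
    move/cvgrPdist_lt : ecvg => /(_ _ m0)[N _ /(_ N (leqnn N))].
    rewrite sub0r normrN gtr0_norm// lt_min => /andP[Na Nb].
    by exists N => //=; rewrite /D/= in_itv/=; lra.
  move=> [n _]; rewrite /D/= !in_itv/= => /andP[ax xb].
  have := e0 n; lra.
have De n x : D n x -> x \in `]a, b[.
  move=> Dx; suff : `]a, b[%classic x by [].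
  by rewrite DE; exists n.
have mf : measurable_fun `]a, b[ f.
  apply: open_continuous_measurable_fun.
    exact: interval_open.
  by move=> x /[!inE] /cf.
have It : (\int[@lebesgue_measure R]_(x in D n) (f x)%:E
            @[n --> \oo] --> \int[@lebesgue_measure R]_(x in `]a, b[) (f x)%:E)%E.
  rewrite DE; apply: ge0_nondecreasing_set_cvg_integral.
  - move=> m n mn; rewrite subsetEset => x; rewrite /D/= !in_itv/=.
    by have := eS _ _ mn; lra.
  - by move=> n; exact: measurable_itv.
  - by move=> n; apply/measurable_EFinP; apply: measurable_funS mf => // x /De.
  - by move=> n x /De xab; rewrite lee_fin f0.
have De' n x : x \in `[a + e n, b - e n] -> x \in `]a, b[.
  by move=> xD; exact: (De n).
have cF x : x \in `]a, b[ -> {for x, continuous F}.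
  move=> xab; apply: differentiable_continuous; apply/derivable1_diffP.
  by have [] := dF x xab.
have IE n : (\int[@lebesgue_measure R]_(x in D n) (f x)%:E =
    (F (b - e n))%:E - (F (a + e n))%:E)%E.
  apply: continuous_FTC2 => //.
  - by apply: within_itv_continuous cf; have := e0 n; lra.
  - split.
    + by move=> x /(subset_itv_oo_cc)/De' /dF[].
    + by apply: cvg_at_right_filter; apply: cF; apply: (De' n); rewrite in_itv/= lexx ltW.
    + by apply: cvg_at_left_filter; apply: cF; apply: (De' n); rewrite in_itv/= lexx ltW.
  - move=> x /(subset_itv_oo_cc)/De' /dF[dFx <-].
    by rewrite derive1E.
have ae : a + e n @[n --> \oo] --> a^'+.
  move=> A [d /= d0 dA].
  move/cvgrPdist_lt : ecvg => /(_ _ d0); apply: filterS => n.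
  rewrite sub0r normrN => ne; apply: dA => /=; last by rewrite ltrDl.
  by rewrite opprD addNKr normrN.
have be : b - e n @[n --> \oo] --> b^'-.
  move=> A [d /= d0 dA].
  move/cvgrPdist_lt : ecvg => /(_ _ d0); apply: filterS => n.
  rewrite sub0r normrN => ne; apply: dA => /=; last by rewrite gtrBl.
  by rewrite opprB addrC subrK.
apply: (cvg_unique _ It) => //.
rewrite (funext IE).
apply: cvgeB => //; [exact: (cvg_comp _ _ be Fr)|exact: (cvg_comp _ _ ae Fl)].
Qed.

(** * Continuity and derivatives of real powers *)

Lemma continuous_powR (R : realType) (p x : R) : 0 < x ->
  {for x, continuous (fun y : R => y `^ p)}.
Proof.
move=> x0; apply: differentiable_continuous; apply/derivable1_diffP.
by apply: derivable_powR; rewrite in_itv/= x0.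
Qed.

Lemma is_derive_powR_comp (R : realType) (g : R -> R) (p x dg : R) :
  0 < g x -> is_derive x 1 g dg ->
  is_derive x 1 (fun y : R => g y `^ p) (p * g x `^ (p - 1) * dg).
Proof.
move=> gx0 dgx.
exact: (@is_derive1_comp _ (fun u : R => u `^ p) g _ _ _
  (is_derive1_powR p gx0) dgx).
Qed.

Lemma is_derive_onem_powR (R : realType) (p x : R) : x < 1 ->
  is_derive x 1 (fun y : R => (1 - y) `^ p) (- (p * (1 - x) `^ (p - 1))).
Proof.
move=> x1; have x0 : 0 < 1 - x by rewrite subr_gt0.
have d1 : is_derive x 1 (fun y : R => 1 - y) (-1).
  by apply: is_derive_eq; rewrite add0r mul1r.
rewrite -[X in is_derive _ _ _ X]mulrN1.
exact: (@is_derive_powR_comp _ (fun y : R => 1 - y)).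
Qed.

(** * The incomplete Beta function: integrability, derivative, monotonicity *)

Section incomplete_beta.
Variables (R : realType) (a b : R).
Hypotheses (a0 : 0 < a) (b0 : 0 < b).
Let mu := @lebesgue_measure R.
Let f (y : R) : R := y `^ (a - 1) * (1 - y) `^ (b - 1).

Let f_ge0 y : 0 <= f y. Proof. by rewrite mulr_ge0// powR_ge0. Qed.

Let f_gt0 y : 0 < y < 1 -> 0 < f y.
Proof. by case/andP=> y0 y1; rewrite mulr_gt0// powR_gt0// subr_gt0. Qed.

Let continuous_onem_powR (p y : R) : y < 1 ->
  {for y, continuous (fun y : R => (1 - y) `^ p)}.
Proof.
move=> y1; apply: differentiable_continuous; apply/derivable1_diffP.
by have [] := is_derive_onem_powR p y1.
Qed.

Let continuous_f y : 0 < y < 1 -> {for y, continuous f}.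
Proof.
case/andP=> y0 y1; apply: cvgM; first exact: continuous_powR.
exact: continuous_onem_powR.
Qed.

Let measurable_f (A : set R) : measurable_fun A f.
Proof.
apply: measurable_funTS; apply: measurable_funM; first exact: measurable_powR.
apply: (measurableT_comp (measurable_powR _)).
exact: measurable_funB.
Qed.

(** The integrand is dominated on the open interval by [g], the sum of the two endpoint
    singularities taken separately. Its primitive [G] has finite limits at 0 and 1 because [a] and
    [b] are positive. *)
Lemma integrable_beta : mu.-integrable `[0, 1] (EFin \o f).
Proof.
pose g (y : R) : R := y `^ (a - 1) + (1 - y) `^ (b - 1).
pose G (y : R) : R := a^-1 * y `^ a - b^-1 * (1 - y) `^ b.
have onem0 : 1 - y @[y --> (1:R)^'-] --> (0:R)^'+.
  move=> A [d /= d0 dA]; exists d => //= y /= y1 lty1.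
  apply: dA; rewrite /=; first by rewrite sub0r normrN.
  by rewrite subr_gt0.
have Ig : (\int[mu]_(x in `]0%R, 1%R[) (g x)%:E = a^-1%:E - (- b^-1)%:E)%E.
  apply: (@ge0_continuous_FTC2oo _ _ G) => //.
  - move=> y; rewrite in_itv/= => /andP[y0 y1]; apply: cvgD.
      exact: continuous_powR.
    exact: continuous_onem_powR.
  - by move=> y _; rewrite addr_ge0// powR_ge0.
  - move=> y; rewrite in_itv/= => /andP[y0 y1].
    have d1 := is_derive1_powR a y0; have d2 := is_derive_onem_powR b y1.
    rewrite (_ : g y = a^-1 * (a * y `^ (a - 1)) -
       b^-1 * (- (b * (1 - y) `^ (b - 1)))); last first.
      by rewrite /g mulrN opprK !mulrA !mulVf ?gt_eqF// !mul1r.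
    exact: (is_deriveB (is_deriveZ a^-1 d1) (is_deriveZ b^-1 d2)).
  - apply: cvg_EFin; first exact: nearW.
    rewrite (_ : - b^-1 = a^-1 * 0 - b^-1 * (1 - 0) `^ b); last first.
      by rewrite subr0 powR1 mulr0 mulr1 sub0r.
    apply: cvgB; apply: cvgMr; first exact: powR_cvg0.
    by apply: cvg_at_right_filter; exact: (@continuous_onem_powR b 0).
  - apply: cvg_EFin; first exact: nearW.
    rewrite (_ : a^-1 = a^-1 * 1 `^ a - b^-1 * 0); last first.
      by rewrite powR1 mulr0 mulr1 subr0.
    apply: cvgB; apply: cvgMr.
      by apply: cvg_at_left_filter; exact: (@continuous_powR _ a 1).
    exact: (cvg_comp _ _ onem0 (powR_cvg0 b0)).
apply/integrableP; split; first by apply/measurable_EFinP; exact: measurable_f.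
have mabs : measurable_fun (`]0, 1[ : set R) (fun x : R => `|(EFin \o f) x|%E).
  by apply: measurableT_comp => //; apply/measurable_EFinP; exact: measurable_f.
rewrite (integral_itv_bndoo _ _ mabs).
apply: (@le_lt_trans _ _ (\int[mu]_(x in `]0%R, 1%R[) (g x)%:E)%E); last first.
  by rewrite Ig ltry.
apply: ge0_le_integral => //=.
- apply/measurable_EFinP; apply: measurable_funTS; apply: measurable_funD.
    exact: measurable_powR.
  apply: (measurableT_comp (measurable_powR _)).
  exact: measurable_funB.
- move=> y; rewrite in_itv/= => /andP[y0 y1].
  have oy0 : 0 < 1 - y by rewrite subr_gt0.
  rewrite lee_fin ger0_norm ?f_ge0// /f /g.
  (* [1 / (y (1 - y)) = 1 / y + 1 / (1 - y)] *)
  have E : y `^ (a - 1) * (1 - y) `^ (b - 1) =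
      y `^ (a - 1) * (1 - y) `^ b + y `^ a * (1 - y) `^ (b - 1).
    rewrite -(mulr_powRB1 (ltW y0) a0) -(mulr_powRB1 (ltW oy0) b0); ring.
  have le1 u c : 0 < u -> u < 1 -> 0 < c -> u `^ c <= 1.
    by move=> u0 u1 c0; rewrite -[leRHS](powRr0 u) ger_powR// ?u0 ltW.
  rewrite E lerD//.
    by rewrite ler_piMr ?powR_ge0// le1// gtrBl.
  by rewrite ler_piMl ?powR_ge0// le1.
Qed.

Lemma continuous_incBeta : {within `[0, 1], continuous (fun x => incBeta x a b)}.
Proof. exact: parameterized_integral_continuous integrable_beta. Qed.

Lemma is_derive_incBeta (x : R) : 0 < x < 1 ->
  is_derive x 1 (fun y : R => incBeta y a b)
    (x `^ (a - 1) * (1 - x) `^ (b - 1)).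
Proof.
move=> /[dup] x01 /andP[x0 x1].
have [dF dFE] :=
  continuous_FTC1_closed x1 integrable_beta x0 (continuous_f x01).
by split; [exact: dF|rewrite -derive1E; exact: dFE].
Qed.

Lemma incBeta0 : incBeta 0 a b = 0.
Proof. by rewrite /incBeta set_itv1 Rintegral_set1. Qed.

(** The mean value theorem asks for a derivative only inside the interval, where it is positive; at
    0 and 1 continuity is enough, so these endpoints are covered. *)
Lemma incBeta_lt (x y : R) : 0 <= x -> x < y -> y <= 1 ->
  incBeta x a b < incBeta y a b.
Proof.
move=> x0 xy y1.
have [||z + E] := @MVT _ (fun z => incBeta z a b) f x y xy.
- move=> z; rewrite in_itv/= => /andP[xz zy]; apply: is_derive_incBeta.
  by rewrite (le_lt_trans x0)//= (lt_le_trans zy).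
- apply: continuous_subspaceW; last exact: continuous_incBeta.
  by apply: subset_itvScc; rewrite bnd_simp.
- rewrite in_itv/= => /andP[xz zy].
  rewrite -subr_gt0 E mulr_gt0 ?subr_gt0// f_gt0//.
  by rewrite (le_lt_trans x0)//= (lt_le_trans zy).
Qed.

Lemma incBeta_ge0 (x : R) : 0 <= x <= 1 -> 0 <= incBeta x a b.
Proof.
case/andP; rewrite le_eqVlt => /predU1P[<-|x0] x1; first by rewrite incBeta0.
by rewrite -incBeta0 ltW// incBeta_lt.
Qed.

Lemma incBeta_le1 (x : R) : 0 <= x <= 1 -> incBeta x a b <= incBeta 1 a b.
Proof.
case/andP=> x0; rewrite le_eqVlt => /predU1P[->//|x1].
by rewrite ltW// incBeta_lt.
Qed.

Lemma incBeta1_gt0 : 0 < incBeta 1 a b.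
Proof. by rewrite -incBeta0 incBeta_lt. Qed.

End incomplete_beta.

(** * The Moebius substitution off the diagonal *)

(** To be read with [p = e * (z - s)], [q = e * (z - r)], [w = e * (r - s)], where [e] is a sign.
    The bases on the left are then [F z] and [1 - F z] for the Moebius map [F], and the last factor
    is [e] times its derivative. The right-hand side is the integrand of the kernel. *)
Lemma mobius_power_identity (R : realType) (al be s r z p q w : R) :
  2 * al + be = 1 ->
  0 < s -> 0 < r -> 0 < z -> 0 < p -> 0 < q -> 0 < w ->
  (s * r) `^ (- al) * w `^ (- be) *
    ((s / r * (q / p)) `^ (al - 1) * (z * w / (r * p)) `^ (be - 1) *
     (s / r * (w / p ^+ 2))) =
  p `^ (al - 1) * z `^ (be - 1) * q `^ (al - 1).
Proof.
move=> albe s0 r0 z0 p0 q0 w0.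
(* Writing every positive variable as the exponential of its logarithm reduces the claim to a
   polynomial identity between exponents. *)
rewrite -[s]lnK// -[r]lnK// -[z]lnK// -[p]lnK// -[q]lnK// -[w]lnK//.
have -> : be = 1 - 2 * al by lra.
do ?rewrite -?expRM_natl -?expRN -?expRD -?expRM.
by congr expR; ring.
Qed.

(* [s (z - r) / (r (z - s))] maps one of the intervals [r, +oo[ (if [s < r])
   and [0, r] (if [r < s]) into [0, 1]; the sign [e] of [r - s] tells which. *)
Lemma integral_mobius_beta (R : realType) (al be s r e c d : R) :
  0 < al -> 0 < be -> 2 * al + be = 1 -> 0 < s -> 0 < r -> e * e = 1 ->
  0 < e * (r - s) -> c < d ->
  {in `[c, d], forall z, 0 <= z} -> {in `[c, d], forall z, 0 <= e * (z - r)} ->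
  let F (z : R) : R := s / r * ((z - r) / (z - s)) in
  (\int[@lebesgue_measure R]_(z in `]c, d[)
     ((e * (z - s)) `^ (al - 1) * z `^ (be - 1)
      * (e * (z - r)) `^ (al - 1))%:E =
   ((s * r) `^ (- al) * (e * (r - s)) `^ (- be) *
     (e * (incBeta (F d) al be - incBeta (F c) al be)))%:E)%E.
Proof.
move=> al0 be0 albe s0 r0 ee w0 cd z0 q0 F.
set C := _ `^ (- al) * _.
have cdoo z : z \in `]c, d[ -> z \in `[c, d] by exact: subset_itv_oo_cc.
have p0 z : z \in `[c, d] -> 0 < e * (z - s).
  by move=> /q0; move: w0; rewrite !mulrBr; lra.
have e0 : e != 0 by apply/eqP => e0; move: w0; rewrite e0 mul0r ltxx.
have zs z : z \in `[c, d] -> z - s != 0.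
  by move=> /p0 h; apply/eqP => zs; move: h; rewrite zs mulr0 ltxx.
have FE z : z \in `[c, d] -> F z = s / r * (e * (z - r) / (e * (z - s))).
  by move=> zcd; rewrite /F -mulf_div divff// mul1r.
have onemFE z : z \in `[c, d] ->
    1 - F z = z * (e * (r - s)) / (r * (e * (z - s))).
  by move=> zcd; rewrite /F; field; rewrite e0 zs// gt_eqF.
have F01 z : z \in `[c, d] -> 0 <= F z <= 1.
  move=> zcd; apply/andP; split.
    by rewrite FE// mulr_ge0// divr_ge0 ?q0// ltW// p0.
  rewrite -subr_ge0 onemFE// divr_ge0// mulr_ge0//.
  - exact: z0.
  - exact: ltW.
  - exact: ltW.
  - by rewrite ltW// p0.
(* An affine function of nonzero slope that is nonnegative at both ends is positive in between. *)
have ends : {in `]c, d[, forall z, 0 < z /\ 0 < e * (z - r)}.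
  move=> z zcd.
  have q1 : 0 <= e * (c - r) by apply: q0; rewrite in_itv/= lexx ltW.
  have q2 : 0 <= e * (d - r) by apply: q0; rewrite in_itv/= lexx ltW.
  have c0 : 0 <= c by apply: z0; rewrite in_itv/= lexx ltW.
  move: zcd; rewrite in_itv/= => /andP[cz zd]; split.
    exact: le_lt_trans cz.
  move: e0; rewrite neq_lt => /orP[e0|e0]; nra.
have F01' z : z \in `]c, d[ -> 0 < F z < 1.
  move=> zcd; have [z0' q0'] := ends z zcd; have p0' := p0 z (cdoo z zcd).
  apply/andP; split.
    by rewrite FE ?cdoo// mulr_gt0// divr_gt0.
  by rewrite -subr_gt0 onemFE ?cdoo// divr_gt0// mulr_gt0.
have dF z : z \in `[c, d] ->
    is_derive z 1 F (s / r * ((r - s) / (z - s) ^+ 2)).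
  move=> zcd.
  have dr : is_derive z 1 (fun y : R => y - r) 1.
    by apply: is_derive_eq; rewrite subr0.
  have ds : is_derive z 1 (fun y : R => y - s) 1.
    by apply: is_derive_eq; rewrite subr0.
  have dV := @is_deriveV _ (fun y : R => y - s) z 1 1 (zs z zcd) ds.
  apply: (is_derive_eq (is_deriveZ (s / r) (is_deriveM dr dV))).
  rewrite /GRing.scale/=; field; rewrite zs// gt_eqF//.
(* At the ends [F] may take the values 0 and 1, where [incBeta] is known to be continuous only from
   within [[0, 1]]. The composition therefore uses that [F] maps [[c, d]] into [[0, 1]]. *)
have cF : {within `[c, d], continuous (fun z => incBeta (F z) al be)}.
  apply/subspace_continuousP => z zcd.
  have /subspace_continuousP/(_ (F z)) := continuous_incBeta al0 be0.
  rewrite /= in_itv/= => /(_ (F01 z zcd)) cB.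
  apply: (cvg_comp F (fun x => incBeta x al be) _ cB) => P /=.
  have cFz : {for z, continuous F}.
    apply: differentiable_continuous; apply/derivable1_diffP.
    by have [] := dF z zcd.
  move=> /cFz FP.
  suff : nbhs z (fun y => y \in `[c, d] -> P (F y)) by [].
  have : nbhs z (fun y => F y \in `[0, 1] -> P (F y)) by [].
  by apply: filterS => y + ycd; apply; rewrite in_itv/=; exact: F01.
have [_ Fc Fd] := (continuous_within_itvP _ cd).1 cF.
(* The factor [e] in the primitive offsets the sign of the derivative of [F], which is that of
   [r - s]. *)
have h : (\int[@lebesgue_measure R]_(z in `]c, d[)
     ((e * (z - s)) `^ (al - 1) * z `^ (be - 1)
      * (e * (z - r)) `^ (al - 1))%:E =
   (C * e * incBeta (F d) al be)%:E - (C * e * incBeta (F c) al be)%:E)%E.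
  apply: (@ge0_continuous_FTC2oo _ _ (fun z => C * e * incBeta (F z) al be)).
  - exact: cd.
  - move=> z zcd; have [z0' q0'] := ends z zcd; have p0' := p0 z (cdoo z zcd).
    have cp (u : R) : 0 < e * (z - u) ->
        {for z, continuous (fun y : R => (e * (y - u)) `^ (al - 1))}.
      move=> eu; apply: (@continuous_comp _ _ _ (fun y : R => e * (y - u))
        (fun y : R => y `^ (al - 1))).
        by apply: cvgMr; apply: cvgB; [exact: cvg_id|exact: cvg_cst].
      exact: continuous_powR.
    apply: cvgM; last exact: cp.
    by apply: cvgM; [exact: cp|exact: continuous_powR].
  - by move=> z _; rewrite !mulr_ge0// powR_ge0.
  - move=> z zcd; have [z0' q0'] := ends z zcd; have p0' := p0 z (cdoo z zcd).
    have dI := is_derive_incBeta al0 be0 (F01' z zcd).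
    have dIF := is_derive1_comp dI (dF z (cdoo z zcd)).
    apply: (is_derive_eq (is_deriveZ (C * e) dIF)).
    rewrite /GRing.scale/= -(mobius_power_identity albe s0 r0 z0' p0' q0' w0) -/C.
    rewrite onemFE ?cdoo// FE ?cdoo//.
    have -> : (e * (z - s)) ^+ 2 = (z - s) ^+ 2.
      by rewrite exprMn expr2 ee mul1r.
    ring.
  - by apply: cvg_EFin; [exact: nearW|exact: cvgMr].
  - by apply: cvg_EFin; [exact: nearW|exact: cvgMr].
  - by [].
rewrite h -EFinB; congr EFin; ring.
Qed.

(** * Divergence of the integrals on the diagonal *)

Lemma powR_cvgy (R : realType) (T : Type) (F : set_system T) (FF : Filter F)
    (f : T -> R) (p : R) : 0 < p ->
  f x @[x --> F] --> +oo -> f x `^ p @[x --> F] --> +oo.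
Proof.
move=> p0 /cvgryPge fy; apply/cvgryPge => A.
have A0 : 0 <= Num.max A 0 by rewrite le_max lexx orbT.
near=> x.
rewrite (@le_trans _ _ (Num.max A 0)) ?le_max ?lexx//.
rewrite -[leLHS](powRr1 A0) -(@mulVf _ p) ?gt_eqF// powRrM.
have fx : (Num.max A 0) `^ p^-1 <= f x by near: x; exact: fy.
apply: ge0_ler_powR => //; rewrite ?nnegrE ?powR_ge0//; first exact: ltW.
by apply: le_trans fx; exact: powR_ge0.
Unshelve. all: by end_near. Qed.

Section diagonal.
Variables (R : realType) (al be s e : R).
Hypotheses (be0 : 0 < be) (albe : 2 * al + be = 1) (s0 : 0 < s) (ee : e * e = 1).
Let G (z : R) : R := - (e / (be * s)) * (z / (e * (z - s))) `^ be.

Lemma integral_mobius_diagonal (c d : R) (l r : \bar R) : c < d ->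
  {in `]c, d[, forall z, 0 < z} -> {in `]c, d[, forall z, 0 < e * (z - s)} ->
  (G z)%:E @[z --> c^'+] --> l -> (G z)%:E @[z --> d^'-] --> r -> (r +? - l)%E ->
  (\int[@lebesgue_measure R]_(z in `]c, d[)
     ((e * (z - s)) `^ (al - 1) * z `^ (be - 1)
      * (e * (z - s)) `^ (al - 1))%:E = r - l)%E.
Proof.
move=> cd z0 p0; have beE : be = 1 - 2 * al by apply/esym/eqP; rewrite subr_eq addrC albe.
apply: ge0_continuous_FTC2oo => //.
- move=> z zcd.
  have cp : {for z, continuous (fun y : R => (e * (y - s)) `^ (al - 1))}.
    apply: (@continuous_comp _ _ _ (fun y : R => e * (y - s))
      (fun y : R => y `^ (al - 1))).
      by apply: cvgMr; apply: cvgB; [exact: cvg_id|exact: cvg_cst].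
    exact/continuous_powR/p0.
  apply: cvgM; last exact: cp.
  by apply: cvgM; [exact: cp|exact/continuous_powR/z0].
- by move=> z _; rewrite !mulr_ge0// powR_ge0.
- move=> z zcd; have z0' := z0 z zcd; have p0' := p0 z zcd.
  have zs : e * (z - s) != 0 by rewrite gt_eqF.
  have zs' : z - s != 0 by move: zs; rewrite mulf_eq0 negb_or => /andP[].
  have e0 : e != 0 by move: zs; rewrite mulf_eq0 negb_or => /andP[].
  have zp : 0 < z / (e * (z - s)) by rewrite divr_gt0.
  have d1 : is_derive z 1 (fun y : R => e * (y - s)) e.
    by apply: is_derive_eq; rewrite subr0 /GRing.scale/= mulr1.
  have dV := @is_deriveV _ (fun y : R => e * (y - s)) z e 1 zs d1.
  have dM := is_deriveM (is_derive_id z (1 : R)) dV.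
  have dP := @is_derive_powR_comp _ (fun y : R => y / (e * (y - s))) be _ _ zp dM.
  apply: (is_derive_eq (is_deriveZ (- (e / (be * s))) dP)).
  have <- : (z / (e * (z - s))) `^ (be - 1) / (e * (z - s)) ^+ 2 =
      (e * (z - s)) `^ (al - 1) * z `^ (be - 1) * (e * (z - s)) `^ (al - 1).
    move: (e * (z - s)) p0' => p p0'.
    rewrite -[p]lnK// -[z]lnK//.
    rewrite beE; do ?rewrite -?expRM_natl -?expRN -?expRD -?expRM.
    by congr expR; ring.
  have -> : z *: (- (e * (z - s)) ^- 2 *: e) + (e * (z - s))^-1 *: 1 =
      - (e * s) / (e * (z - s)) ^+ 2.
    by rewrite /GRing.scale/=; field; rewrite zs' e0.
  rewrite /GRing.scale/=.
  transitivity (e * e * ((z / (e * (z - s))) `^ (be - 1) / (e * (z - s)) ^+ 2)).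
    by field; rewrite zs' e0 !gt_eqF.
  by rewrite ee mul1r.
Qed.
End diagonal.

(** The divergence is at the left end: [z / (z - s)] tends to [+oo] there, so the primitive tends to
    [-oo], while it is finite at [d]. *)
Lemma integral_diagonal_right (R : realType) (al be s d : R) :
  0 < be -> 2 * al + be = 1 -> 0 < s -> s < d ->
  (\int[@lebesgue_measure R]_(z in `]s, d[)
     ((z - s) `^ (al - 1) * z `^ (be - 1) * (z - s) `^ (al - 1))%:E = +oo)%E.
Proof.
move=> be0 albe s0 sd.
under eq_integral do rewrite -[X in X `^ (al - 1)]mul1r.
pose G (z : R) : R := - (1 / (be * s)) * (z / (1 * (z - s))) `^ be.
rewrite (@integral_mobius_diagonal R al be s 1 be0 albe s0 (mulr1 1) _ _
  -oo (G d)%:E) //.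
- by move=> z; rewrite in_itv/= => /andP[+ _]; exact: lt_trans.
- by move=> z; rewrite in_itv/= => /andP[sz _]; rewrite mul1r subr_gt0.
- have bs0 : 0 < 1 / (be * s) by rewrite divr_gt0// mulr_gt0.
  apply/cvgerNyP; under eq_fun do rewrite mulNr.
  apply/cvgNrNy; apply: gt0_cvgMry => //; apply: powR_cvgy => //.
  apply/cvgryPge => A; near=> z.
  have sz : 0 < z - s by rewrite subr_gt0; near: z; exact: nbhs_right_gt.
  have A0 : 0 < `|A| + 1 by rewrite ltr_wpDl.
  have zA : z - s < s / (`|A| + 1).
    by near: z; apply: nbhs_right_ltDr; rewrite divr_gt0.
  rewrite mul1r ler_pdivlMr//.
  rewrite ltr_pdivlMr// in zA.
  have := ler_norm A; nra.
- apply: cvg_EFin; first exact: nearW.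
  apply: cvg_at_left_filter; apply: cvgMr.
  apply: (@continuous_comp _ _ _ (fun y : R => y / (1 * (y - s)))
    (fun y : R => y `^ be)).
    apply: cvgM; first exact: cvg_id.
    apply: cvgV; first by rewrite mul1r subr_eq0 gt_eqF.
    by apply: cvgMr; apply: cvgB; [exact: cvg_id|exact: cvg_cst].
  by apply: continuous_powR; rewrite mul1r divr_gt0 ?subr_gt0// (lt_trans s0).
Unshelve. all: by end_near. Qed.

(** With sign -1 the primitive starts from 0 at 0 and tends to [+oo] at the right end [s]. *)
Lemma integral_diagonal_left (R : realType) (al be s : R) :
  0 < be -> 2 * al + be = 1 -> 0 < s ->
  (\int[@lebesgue_measure R]_(z in `]0%R, s[)
     ((s - z) `^ (al - 1) * z `^ (be - 1) * (s - z) `^ (al - 1))%:E = +oo)%E.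
Proof.
move=> be0 albe s0.
have opp z : s - z = -1 * (z - s) by rewrite mulN1r opprB.
under eq_integral do rewrite opp.
have m11 : -1 * -1 = 1 :> R by rewrite mulN1r opprK.
rewrite (@integral_mobius_diagonal R al be s (-1) be0 albe s0 m11 _ _
  0 +oo) //.
- by move=> z; rewrite in_itv/= => /andP[].
- by move=> z; rewrite in_itv/= => /andP[_ zs]; rewrite -opp subr_gt0.
- apply: cvg_EFin; first exact: nearW.
  rewrite -[X in _ --> X](mulr0 (- (-1 / (be * s)))); apply: cvgMr.
  suff h : z / (-1 * (z - s)) @[z --> (0:R)^'+] --> (0:R)^'+.
    exact: (cvg_comp _ _ h (powR_cvg0 be0)).
  have h0 : z / (-1 * (z - s)) @[z --> (0:R)^'+] --> (0:R).
    apply: cvg_at_right_filter; rewrite -[X in _ --> X](mul0r (-1 * (0 - s))^-1).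
    apply: cvgM; first exact: cvg_id.
    apply: cvgV; first by rewrite -opp subr0 gt_eqF.
    by apply: cvgMr; apply: cvgB; [exact: cvg_id|exact: cvg_cst].
  move=> A A0; have hA : \forall z \near (0:R)^'+,
      0 < z / (-1 * (z - s)) -> A (z / (-1 * (z - s))) by exact: h0 A0.
  suff : \forall z \near (0:R)^'+, A (z / (-1 * (z - s))) by [].
  near=> z; have := near hA z; apply=> //.
  rewrite -opp divr_gt0// subr_gt0; near: z; exact: nbhs_right_lt.
- have bs0 : 0 < - (-1 / (be * s)) by rewrite mulN1r opprK invr_gt0 mulr_gt0.
  apply/cvgeryP; apply: gt0_cvgMry => //; apply: powR_cvgy => //.
  apply/cvgryPge => A; near=> z.
  have sz : 0 < s - z by rewrite subr_gt0; near: z; exact: nbhs_left_lt.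
  have A0 : 0 < `|A| + 1 by rewrite ltr_wpDl.
  (* Here [z / (s - z)] is [s / (s - z) - 1]; the constant 2 absorbs the loss of 1. *)
  have zA : s - z < s / (`|A| + 2).
    by near: z; apply: nbhs_left_ltBl; rewrite divr_gt0// ltr_wpDl.
  rewrite -opp ler_pdivlMr//.
  rewrite ltr_pdivlMr ?ltr_wpDl// in zA.
  have := ler_norm A; nra.
Unshelve. all: by end_near. Qed.

(** * Limits of extended inverses and of powers, up to base 0 *)

(** Nonnegativity makes a limit [l = 0] one from above, consistent with the inverse of 0 being
    [+oo]. This case occurs at the corner (0, 0) when H > 1/2. *)
Lemma cvg_inve (R : realType) (T : Type) (F : set_system T) (FF : Filter F)
    (f : T -> R) (l : R) : (\forall x \near F, 0 <= f x) ->
  f x @[x --> F] --> l -> (((f x)%:E)^-1)%E @[x --> F] --> ((l%:E)^-1)%E.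
Proof.
move=> f0 fl; rewrite inver; case: (eqVneq l 0) => [l0|l0].
  apply/cvgeyPge => A; near=> x.
  have fA : f x < (`|A| + 1)^-1.
    near: x; rewrite l0 in fl.
    have A1 : 0 < (`|A| + 1)^-1 by rewrite invr_gt0 ltr_wpDl.
    move/cvgrPdist_lt : fl => /(_ _ A1).
    by apply: filterS => y; rewrite sub0r normrN; apply: le_lt_trans; exact: ler_norm.
  rewrite inver; case: eqP => [_|/eqP fx0]; first exact: leey.
  have fx : 0 < f x by rewrite lt_neqAle eq_sym fx0; near: x.
  rewrite lee_fin (le_trans (ler_norm A))// -[leRHS]mul1r ler_pdivlMr//.
  have A0 : 0 < `|A| + 1 by rewrite ltr_wpDl.
  rewrite -[X in _ < X]mul1r ltr_pdivlMr// in fA.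
  nra.
have fn0 : \forall x \near F, f x != 0 by exact: (cvgr_neq0 _ fl).
apply: cvg_EFin.
  by apply: filterS fn0 => x fx0; rewrite inver (negbTE fx0).
apply: (@cvg_trans _ ((f x)^-1 @[x --> F])); last exact: cvgV.
apply: near_eq_cvg; apply: filterS fn0 => x fx0.
by rewrite /= inver (negbTE fx0).
Unshelve. all: by end_near. Qed.

Lemma cvg_powR (R : realType) (T : Type) (F : set_system T) (FF : Filter F)
    (f : T -> R) (l p : R) : 0 < p -> 0 <= l -> (\forall x \near F, 0 <= f x) ->
  f x @[x --> F] --> l -> f x `^ p @[x --> F] --> l `^ p.
Proof.
move=> p0; rewrite le_eqVlt => /predU1P[<-|l0] f0 fl; last first.
  have cp : y `^ p @[y --> l] --> l `^ p by exact: continuous_powR.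
  exact: (cvg_comp f (fun y : R => y `^ p) fl cp).
rewrite powR0 ?gt_eqF//; apply/cvgrPdist_lt => eps eps0; near=> x.
have fx : 0 <= f x by near: x.
rewrite sub0r normrN ger0_norm ?powR_ge0//.
rewrite -[ltRHS](powRr1 (ltW eps0)) -(@mulVf _ p) ?gt_eqF// powRrM.
apply: gt0_ltr_powR; rewrite ?nnegrE ?powR_ge0//.
near: x; have e0 : 0 < eps `^ p^-1 by rewrite powR_gt0.
move/cvgrPdist_lt : fl => /(_ _ e0).
by apply: filterS => y; rewrite sub0r normrN; apply: le_lt_trans; exact: ler_norm.
Unshelve. all: by end_near. Qed.

(** * Symmetry of the kernel; values of the Beta argument *)

Lemma varkappaC (R : realType) (H T t v : R) :
  varkappa H T t v = varkappa H T v t.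
Proof.
rewrite /varkappa (mulrC t) maxC minC.
have rev (a b c : R) : a * b * c = c * b * a by ring.
case: (H < 2^-1).
  under eq_integral do rewrite rev.
  by [].
under eq_integral do rewrite rev.
by [].
Qed.

Lemma beta_argC (R : realType) (T t v : R) : beta_arg T t v = beta_arg T v t.
Proof. by rewrite /beta_arg maxC minC. Qed.

(** The denominator is [+oo], whose inverse is 0; the product is 0 even for [v = 0], where the
    numerator is [+oo]. *)
Lemma beta_arg0 (R : realType) (T v : R) : 0 < T -> 0 <= v ->
  beta_arg T 0 v = 0.
Proof.
move=> T0 v0; rewrite /beta_arg min_l// inve0 gt0_muley ?lte_fin// addye//.
by rewrite invey mule0.
Qed.

Lemma beta_argT (R : realType) (T t : R) : 0 < T -> t <= T -> beta_arg T t T = 0.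
Proof.
move=> T0 tT; rewrite /beta_arg max_r// inver gt_eqF// -EFinM divff ?gt_eqF//.
by rewrite -EFinB subrr mul0e.
Qed.

Lemma beta_argE (R : realType) (T t v : R) : 0 < t -> t <= v -> v < T ->
  beta_arg T t v = t * (T - v) / (v * (T - t)).
Proof.
move=> t0 tv vT; have v0 := lt_le_trans t0 tv; have T0 := lt_trans v0 vT.
have tT := le_lt_trans tv vT.
rewrite /beta_arg max_r// min_l// !inver !gt_eqF// -!EFinM -!EFinB inver.
have -> : T / t - 1 = (T - t) / t by field; rewrite gt_eqF.
rewrite gt_eqF ?divr_gt0 ?subr_gt0// -EFinM/=.
by field; rewrite subr_eq0 !gt_eqF.
Qed.

Lemma beta_arg_itv (R : realType) (T t v : R) : 0 < T ->
  0 <= t <= T -> 0 <= v <= T -> 0 <= beta_arg T t v <= 1.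
Proof.
wlog tv : t v / t <= v => [hw T0 ht hv|T0].
  by case: (leP t v) => [|/ltW] tv; [exact: hw|rewrite beta_argC; exact: hw].
case/andP; rewrite le_eqVlt => /predU1P[<- _|t0 _] /andP[v0].
  by rewrite beta_arg0// lexx ler01.
rewrite le_eqVlt => /predU1P[vT|vT].
  by rewrite vT beta_argT// ?lexx ?ler01// -vT.
have Tt : 0 < T - t by rewrite subr_gt0 (le_lt_trans tv).
have v1 := lt_le_trans t0 tv.
rewrite beta_argE//; apply/andP; split.
  by apply: divr_ge0; apply: mulr_ge0; rewrite ?subr_ge0// ltW// -subr_gt0.
rewrite ler_pdivrMr ?mulr_gt0// mul1r.
have : t * T <= v * T by rewrite ler_pM2r.
lra.
Qed.

(** * Closed forms of the kernel *)

Lemma half_exponent (R : realType) (H : R) : - 2^-1 - H = 2^-1 - H - 1.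
Proof. by field. Qed.

(** For [0 < t < v < T] the Moebius map with [s = t], [r = v] sends [v] to 0 and [T] to
    [beta_arg T t v], and the prefactor of the kernel cancels the power of [s * r]. *)
Lemma varkappa_lt_half (R : realType) (H T t v : R) : 0 < T ->
  0 < H -> H < 2^-1 -> 0 <= t <= T -> 0 <= v <= T ->
  varkappa H T t v = (((`|t - v| `^ (2 * H))%:E)^-1
    * (incBeta (beta_arg T t v) (2^-1 - H) (2 * H))%:E)%E.
Proof.
move=> T0 H0 H12.
wlog tv : t v / t <= v => [hw ht hv|].
  case: (leP t v) => [|/ltW] tv; first exact: hw.
  by rewrite varkappaC beta_argC distrC; exact: hw.
have al0 : 0 < 2^-1 - H by rewrite subr_gt0.
have be0 : 0 < 2 * H by rewrite mulr_gt0.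
have albe : 2 * (2^-1 - H) + 2 * H = 1 by field.
rewrite /varkappa H12 max_r// half_exponent.
(* For [t = 0] both sides vanish: on the left the prefactor is 0, and on the right the incomplete
   Beta value is 0, which also annihilates the [+oo] arising when [v = 0]. *)
case/andP; rewrite le_eqVlt => /predU1P[<- _|t0 tT] /andP[v0 vT].
  by rewrite mul0r powR0 ?gt_eqF// mul0e beta_arg0// incBeta0 mule0.
move: vT; rewrite le_eqVlt => /predU1P[vT|vT].
  rewrite vT set_itv_ge ?bnd_simp ?ltxx// integral_set0 mule0.
  by rewrite beta_argT// incBeta0 mule0.
have v1 := lt_le_trans t0 tv.
(* On the diagonal both sides are [+oo]: the Beta argument is 1, and the complete Beta value is
   positive. *)
move: tv; rewrite le_eqVlt => /predU1P[tv|tv].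
  rewrite -tv in vT v1 *.
  rewrite (integral_diagonal_right be0 albe t0 vT).
  rewrite gt0_muley ?lte_fin ?powR_gt0 ?mulr_gt0//.
  rewrite subrr normr0 powR0 ?gt_eqF// inve0 beta_argE// divff; last first.
    by rewrite mulf_neq0// ?subr_eq0 gt_eqF.
  by rewrite gt0_mulye// lte_fin incBeta1_gt0.
have h : {in `[v, T], forall z, v <= z} by move=> z; rewrite in_itv/= => /andP[].
have -> : (\int[@lebesgue_measure R]_(z in `]v, T[)
    ((z - t) `^ (2^-1 - H - 1) * z `^ (2 * H - 1) *
     (z - v) `^ (2^-1 - H - 1))%:E =
    \int[@lebesgue_measure R]_(z in `]v, T[)
    ((1 * (z - t)) `^ (2^-1 - H - 1) * z `^ (2 * H - 1) *
     (1 * (z - v)) `^ (2^-1 - H - 1))%:E)%E.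
  by apply: eq_integral => z _; rewrite !mul1r.
rewrite (integral_mobius_beta al0 be0 albe t0 v1 (mulr1 1)) //; last 3 first.
- by rewrite mul1r subr_gt0.
- by move=> z /h vz; rewrite (le_trans v0).
- by move=> z /h vz; rewrite mul1r subr_ge0.
rewrite subrr mul0r mulr0 incBeta0 subr0 !mul1r.
rewrite beta_argE//; last exact: ltW.
have -> : t / v * ((T - v) / (T - t)) = t * (T - v) / (v * (T - t)).
  by rewrite mulf_div.
have vt : 0 < v - t by rewrite subr_gt0.
rewrite distrC gtr0_norm// inver gt_eqF ?powR_gt0// -!EFinM; congr EFin.
by rewrite !powRN; field; rewrite !gt_eqF ?powR_gt0 ?mulr_gt0.
Qed.

(** For [t < v] the Moebius map with [s = v], [r = t] sends 0 to 1 and [t] to 0. The image is all of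
    [[0, 1]], hence the complete Beta function and a value free of [T]. *)
Lemma varkappa_gt_half (R : realType) (H T t v : R) :
  2^-1 < H -> H < 1 -> 0 < t -> 0 < v ->
  varkappa H T t v = (((`|t - v| `^ (2 - 2 * H))%:E)^-1
    * (Beta (H - 2^-1) (2 - 2 * H))%:E)%E.
Proof.
move=> H12 H1.
wlog tv : t v / t <= v => [hw t0 v0|t0 v0].
  case: (leP t v) => [|/ltW] tv; first exact: hw.
  by rewrite varkappaC distrC; exact: hw.
have al0 : 0 < H - 2^-1 by rewrite subr_gt0.
have be0 : 0 < 2 - 2 * H by lra.
have albe : 2 * (H - 2^-1) + (2 - 2 * H) = 1 by field.
rewrite /varkappa ltNge (ltW H12)/= min_l//.
have -> : H - 3 / 2 = H - 2^-1 - 1 by field.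
have -> : 1 - 2 * H = 2 - 2 * H - 1 by ring.
have -> : Beta (H - 2^-1) (2 - 2 * H) = incBeta 1 (H - 2^-1) (2 - 2 * H) by [].
move: tv; rewrite le_eqVlt => /predU1P[tv|tv].
  rewrite -tv (integral_diagonal_left be0 albe t0).
  rewrite gt0_muley ?lte_fin ?powR_gt0 ?mulr_gt0//.
  rewrite subrr normr0 powR0 ?gt_eqF// inve0.
  by rewrite gt0_mulye// lte_fin incBeta1_gt0.
have m11 : -1 * -1 = 1 :> R by rewrite mulN1r opprK.
have opp (x y : R) : -1 * (x - y) = y - x by rewrite mulN1r opprB.
have -> : (\int[@lebesgue_measure R]_(z in `]0%R, t[)
    ((t - z) `^ (H - 2^-1 - 1) * z `^ (2 - 2 * H - 1) *
     (v - z) `^ (H - 2^-1 - 1))%:E =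
    \int[@lebesgue_measure R]_(z in `]0%R, t[)
    ((-1 * (z - v)) `^ (H - 2^-1 - 1) * z `^ (2 - 2 * H - 1) *
     (-1 * (z - t)) `^ (H - 2^-1 - 1))%:E)%E.
  by apply: eq_integral => z _; rewrite !opp mulrC mulrA mulrAC.
rewrite (integral_mobius_beta al0 be0 albe v0 t0 m11) //; last 3 first.
- by rewrite opp subr_gt0.
- by move=> z; rewrite in_itv/= => /andP[].
- by move=> z; rewrite in_itv/= => /andP[_ zt]; rewrite opp subr_ge0.
rewrite subrr mul0r mulr0 incBeta0 !sub0r.
have -> : v / t * (- t / - v) = 1.
  by field; rewrite !gt_eqF.
have vt : 0 < v - t by rewrite subr_gt0.
rewrite opp mulN1r opprK distrC gtr0_norm// inver gt_eqF ?powR_gt0// -!EFinM.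
congr EFin; rewrite (mulrC v t) !powRN.
by field; rewrite !gt_eqF ?powR_gt0 ?mulr_gt0.
Qed.

(** * Nonexistence of limits at the corners, and conclusion *)

Lemma not_cvg_two_paths (R : realType) (S T U : Type) (F : set_system S)
    (G1 : set_system T) (G2 : set_system U) (f : S -> R) (g1 : T -> S)
    (g2 : U -> S) (c1 c2 : R) :
  ProperFilter G1 -> ProperFilter G2 ->
  g1 x @[x --> G1] --> F -> g2 x @[x --> G2] --> F ->
  (\forall x \near G1, f (g1 x) = c1) -> (\forall x \near G2, f (g2 x) = c2) ->
  c1 != c2 -> ~ cvg (f x @[x --> F]).
Proof.
move=> PG1 PG2 g1F g2F f1 f2 /eqP c12 fF; apply: c12.
have cst (V : Type) (G : set_system V) (g : V -> S) (c : R) : ProperFilter G ->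
    g x @[x --> G] --> F -> (\forall x \near G, f (g x) = c) ->
    lim (f x @[x --> F]) = c.
  move=> PG gF fc; apply: (@cvg_unique R _ (f (g x) @[x --> G])) => //.
    exact: (cvg_comp g f gF fF).
  apply: (@cvg_trans _ (c @[x --> G])); last exact: cvg_cst.
  by apply: near_eq_cvg; apply: filterS fc => x ->.
by rewrite -(cst _ _ _ _ PG1 g1F f1) (cst _ _ _ _ PG2 g2F f2).
Qed.

Lemma cvg_within_dnbhs (S : Type) (G : set_system S) (T : topologicalType)
    (g : S -> T) (A : set T) (p : T) : Filter G ->
  g x @[x --> G] --> p -> (\forall x \near G, A (g x) /\ g x != p) ->
  g x @[x --> G] --> within A p^'.
Proof.
move=> FG gp Ag P; rewrite /within/= /dnbhs/= => AP.
have : \forall x \near G, g x != p -> A (g x) -> P (g x) by exact: gp AP.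
by apply: filterS2 Ag => x [Ax xp] /(_ xp Ax).
Qed.

(* The inverses of |t - v| `^ _ are taken in the extended reals, so that they
   are +oo on the diagonal.  For H > 1/2 the formula defining the kernel gives
   0 when t or v is 0, so there the identity is stated by continuity from
   (0, T]^2.  Limits at the corners are over points of the square other than
   the corner. *)
Theorem lemma2p2 (R : realType) (T : R) (hT : 0 < T) :
  (forall H : R, 0 < H -> H < 2^-1 ->
    [/\ forall t v : R, 0 <= t <= T -> 0 <= v <= T ->
          varkappa H T t v =
            (((`|t - v| `^ (2 * H))%:E)^-1
             * (incBeta (beta_arg T t v) (2^-1 - H) (2 * H))%:E)%E,
        [bounded numerator H T p | p in `[0, T] `*` `[0, T]],
        ~ cvg (numerator H T p
                 @[p --> within (`[0, T] `*` `[0, T]) (0 : R, 0 : R)^'])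
      & ~ cvg (numerator H T p
                 @[p --> within (`[0, T] `*` `[0, T]) (T, T)^'])]) /\
  (forall H : R, 2^-1 < H -> H < 1 ->
    (forall t v : R, 0 < t <= T -> 0 < v <= T ->
       varkappa H T t v =
         (((`|t - v| `^ (2 - 2 * H))%:E)^-1
          * (Beta (H - 2^-1) (2 - 2 * H))%:E)%E) /\
    (forall t v : R, 0 <= t <= T -> 0 <= v <= T -> Num.min t v = 0 ->
       varkappa H T p.1 p.2
         @[p --> within (`]0, T] `*` `]0, T]) (nbhs (t, v))] -->
         (((`|t - v| `^ (2 - 2 * H))%:E)^-1
          * (Beta (H - 2^-1) (2 - 2 * H))%:E)%E)).
Proof.
split=> H H0 H1.
  have al0 : 0 < 2^-1 - H by rewrite subr_gt0.
  have be0 : 0 < 2 * H by rewrite mulr_gt0.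
  have I1 := incBeta1_gt0 al0 be0.
  split.
  - by move=> t v ht hv; exact: varkappa_lt_half.
  - exists (incBeta 1 (2^-1 - H) (2 * H)); split; first exact: num_real.
    move=> M IM [t v] /= [].
    rewrite /= !in_itv/= => ht hv.
    have h := beta_arg_itv hT ht hv.
    rewrite ger0_norm ?incBeta_ge0// (le_trans _ (ltW IM))//.
    exact: incBeta_le1.
  (* The Beta argument is 1 along the diagonal [(x, x)] and 0 along the edge [(0, x)]. *)
  - apply: (@not_cvg_two_paths _ _ _ _ _ (0:R)^'+ (0:R)^'+ _
      (fun x : R => (x, x)) (fun x : R => (0, x))
      (incBeta 1 (2^-1 - H) (2 * H)) 0).
    + apply: cvg_within_dnbhs.
        exact: cvg_pair (cvg_at_right_filter cvg_id) (cvg_at_right_filter cvg_id).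
      near=> x.
      have x0 : 0 < x by near: x; exact: nbhs_right_gt.
      have xT : x < T by near: x; exact: nbhs_right_lt.
      by rewrite /= !in_itv/= !ltW// xpair_eqE gt_eqF.
    + apply: cvg_within_dnbhs.
        have c0 : (fun=> 0 : R) x @[x --> (0:R)^'+] --> (0:R) by exact: cvg_cst.
        exact: cvg_pair c0 (cvg_at_right_filter cvg_id).
      near=> x.
      have x0 : 0 < x by near: x; exact: nbhs_right_gt.
      have xT : x < T by near: x; exact: nbhs_right_lt.
      by rewrite /= !in_itv/= lexx !ltW// xpair_eqE eqxx gt_eqF.
    + near=> x.
      have x0 : 0 < x by near: x; exact: nbhs_right_gt.
      have xT : x < T by near: x; exact: nbhs_right_lt.
      rewrite /numerator/= beta_argE// divff//.
      by rewrite mulf_neq0// ?subr_eq0 gt_eqF.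
    + near=> x.
      have x0 : 0 < x by near: x; exact: nbhs_right_gt.
      by rewrite /numerator/= beta_arg0 ?ltW// incBeta0.
    + by rewrite gt_eqF.
  (* At the other corner the edge is [(x, T)]. *)
  - apply: (@not_cvg_two_paths _ _ _ _ _ T^'- T^'- _
      (fun x : R => (x, x)) (fun x : R => (x, T))
      (incBeta 1 (2^-1 - H) (2 * H)) 0).
    + apply: cvg_within_dnbhs.
        exact: cvg_pair (cvg_at_left_filter cvg_id) (cvg_at_left_filter cvg_id).
      near=> x.
      have x0 : 0 < x by near: x; exact: nbhs_left_gt.
      have xT : x < T by near: x; exact: nbhs_left_lt.
      by rewrite /= !in_itv/= !ltW// xpair_eqE lt_eqF.
    + apply: cvg_within_dnbhs.
        have cT : (fun=> T) x @[x --> T^'-] --> T by exact: cvg_cst.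
        exact: cvg_pair (cvg_at_left_filter cvg_id) cT.
      near=> x.
      have x0 : 0 < x by near: x; exact: nbhs_left_gt.
      have xT : x < T by near: x; exact: nbhs_left_lt.
      by rewrite /= !in_itv/= lexx !ltW// xpair_eqE eqxx lt_eqF.
    + near=> x.
      have x0 : 0 < x by near: x; exact: nbhs_left_gt.
      have xT : x < T by near: x; exact: nbhs_left_lt.
      rewrite /numerator/= beta_argE// divff//.
      by rewrite mulf_neq0// ?subr_eq0 gt_eqF.
    + near=> x.
      have xT : x < T by near: x; exact: nbhs_left_lt.
      by rewrite /numerator/= beta_argT ?ltW// incBeta0.
    + by rewrite gt_eqF.
split=> [t v /andP[t0 _] /andP[v0 _]|t v ht hv _].
  exact: varkappa_gt_half.
set F := within _ _.
have FF : Filter F by exact: within_filter.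
have be0 : 0 < 2 - 2 * H by lra.
(* Where both coordinates are positive the kernel equals its closed form, so only the continuity of
   the latter, with values in the extended reals, remains. *)
apply: (@cvg_trans _ ((((`|p.1 - p.2| `^ (2 - 2 * H))%:E)^-1
          * (Beta (H - 2^-1) (2 - 2 * H))%:E)%E @[p --> F])).
  apply: near_eq_cvg; rewrite /F near_withinE; apply: nearW => -[x y] /= [].
  rewrite /= !in_itv/= => /andP[x0 _] /andP[y0 _].
  by rewrite varkappa_gt_half.
have h : (((`|p.1 - p.2| `^ (2 - 2 * H))%:E)^-1)%E @[p --> F]
    --> (((`|t - v| `^ (2 - 2 * H))%:E)^-1)%E.
  apply: cvg_inve; first by apply: nearW => p; exact: powR_ge0.
  apply: cvg_powR => //; first exact: nearW.
  apply: cvg_norm; apply: cvgB; apply: cvg_within_filter.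
    exact: cvg_fst.
  exact: cvg_snd.
exact: cvgeZr h.
Unshelve. all: by end_near. Qed.
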